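(* Let $K\in L^\infty(X\times X)$ and let $\widetilde T_\rho$, $\rho\in\mathcal R$, be the integral operator on $\mathcal H$ with kernel $\sqrt{\rho(x)}\,K(x,y)\sqrt{\rho(y)}$. For all $\rho,\sigma\in\mathcal R$, $$\|\widetilde T_\rho-\widetilde T_\sigma\|_{\mathrm{op}}\le 2\|K\|_\infty\|\sqrt\rho-\sqrt\sigma\|_2 .$$ Consequently, $$\|\widetilde T_\rho-\widetilde T_\sigma\|_{\mathrm{op}}\le 2\|K\|_\infty\|\rho-\sigma\|_1^{1/2}.$$
   Context: Let $X=\mathbb R^n$ ($n\ge 1$) with its Borel $\sigma$-algebra and Lebesgue measure $\lambda$; functions are complex-valued. Let $\mathcal H=L^2(X,\lambda)$ with norm $\|\cdot\|_2$, $\|\cdot\|_{\mathrm{op}}$ the operator norm on $\mathcal B(\mathcal H)$, and $\mathcal R=\{\rho\in L^1(X,\lambda):\rho\ge 0\ \lambda\text{-a.e.},\ \int_X\rho\,d\lambda=1\}$. The kernel $K\in L^\infty(X\times X)$ (with respect to $\lambda\otimes\lambda$) is represented by a jointly measurable function. The operator $\widetilde T_\rho\in\mathcal B(\mathcal H)$ is $(\widetilde T_\rho u)(x)=\int_X\sqrt{\rho(x)}\,K(x,y)\sqrt{\rho(y)}\,u(y)\,d\lambda(y)$; it is Hilbert–Schmidt, since its kernel has $L^2(X\times X)$-norm at most $\|K\|_\infty$. *)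

(* Defs.v *)
From HB Require Import structures.
From mathcomp Require Import all_boot all_order all_algebra.
From mathcomp Require Import all_classical all_reals all_analysis.
From mathcomp Require Import complex.
Import Order.TTheory GRing.Theory Num.Theory numFieldNormedType.Exports.

Set Implicit Arguments.
Unset Strict Implicit.
Unset Printing Implicit Defensive.

Local Open Scope classical_set_scope.
Local Open Scope ring_scope.

Section cons_measure.
Local Open Scope ereal_scope.
Context d (T : measurableType d) (R : realType) (n : nat).
Variables (m1 : {sigma_finite_measure set T -> \bar R})
  (m2 : {sigma_finite_measure set (n.-tuple T) -> \bar R}).

Definition cons_pair (p : T * n.-tuple T) : n.+1.-tuple T :=
  [tuple of p.1 :: p.2].

Lemma measurable_cons_pair : measurable_fun [set: T * n.-tuple T] cons_pair.
Proof. exact: measurable_cons. Qed.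

Definition cons_measure : set (n.+1.-tuple T) -> \bar R :=
  pushforward (m1 \x m2) cons_pair.

Let measurable_preimage_cons A : measurable A -> measurable (cons_pair @^-1` A).
Proof.
by move=> mA; rewrite -[X in measurable X]setTI; exact: measurable_cons_pair.
Qed.

Let cons_measure0 : cons_measure set0 = 0.
Proof. by rewrite /cons_measure /pushforward preimage_set0 measure0. Qed.

Let cons_measure_ge0 A : 0 <= cons_measure A.
Proof. by rewrite /cons_measure /pushforward; exact: measure_ge0. Qed.

Let cons_measure_semi_sigma_additive : semi_sigma_additive cons_measure.
Proof.
move=> F mF tF mUF; rewrite /cons_measure /pushforward preimage_bigcup.
apply: measure_semi_sigma_additive.
- by move=> k; exact: measurable_preimage_cons.
- apply/trivIsetP => /= i j _ _ ij; rewrite -preimage_setI.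
  by move/trivIsetP : tF => /(_ _ _ _ _ ij) ->//; rewrite preimage_set0.
- by rewrite -preimage_bigcup; exact: measurable_preimage_cons.
Qed.

HB.instance Definition _ := isMeasure.Build _ _ _
  cons_measure cons_measure0 cons_measure_ge0 cons_measure_semi_sigma_additive.

Let cons_measure_sigma_finite : sigma_finite [set: n.+1.-tuple T] cons_measure.
Proof.
have /sigma_finiteP[F [TF ndF Foo]] := sigma_finiteT m1.
have /sigma_finiteP[G [TG ndG Goo]] := sigma_finiteT m2.
pose uncons (t : n.+1.-tuple T) : T * n.-tuple T :=
  (thead t, [tuple of behead t]).
have consK : cancel cons_pair uncons.
  by case=> x t; congr pair; exact/val_inj.
exists (fun k => uncons @^-1` (F k `*` G k)).
  rewrite -preimage_bigcup -[LHS](preimage_setT uncons) -setXTT TF TG.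
  congr preimage; apply/seteqP; split=> -[x y].
    move=> [/= [i _ Fx] [j _ Gy]]; exists (maxn i j) => //; split.
    - by move: x Fx; exact/subsetPset/ndF/leq_maxl.
    - by move: y Gy; exact/subsetPset/ndG/leq_maxr.
  by move=> [i _ []/= ? ?]; split; exists i.
move=> k; have [mF Fkoo] := Foo k; have [mG Gkoo] := Goo k; split.
  rewrite -[X in measurable X]setTI.
  have : measurable_fun [set: n.+1.-tuple T] uncons.
    apply: measurable_fun_pair => /=; first exact: measurable_tnth.
    exact: measurable_behead.
  by apply => //; exact: measurableX.
rewrite /cons_measure /pushforward -comp_preimage (_ : _ \o _ = id); last first.
  by apply/funext => p /=; rewrite consK.
by rewrite preimage_id product_measure1E// lte_mul_pinfty// ge0_fin_numE.
Qed.

HB.instance Definition _ := Measure_isSigmaFinite.Build _ _ _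
  cons_measure cons_measure_sigma_finite.

End cons_measure.

(* R^n, with the product of the Borel sigma-algebras of R, which is its Borel
   sigma-algebra *)
Notation Rn R n := (n.-tuple (measurableTypeR R)).

Fixpoint lebesgue_Rn (R : realType) (n : nat) :
    {sigma_finite_measure set (Rn R n) -> \bar R} :=
  if n is k.+1 then cons_measure (@lebesgue_measure R) (lebesgue_Rn R k)
  else dirac [tuple].

Lemma lebesgue_Rn_box (R : realType) (n : nat)
    (A : 'I_n -> set (measurableTypeR R)) : (forall i, measurable (A i)) ->
  (lebesgue_Rn R n [set t | forall i, A i (tnth t i)] =
   \prod_(i < n) lebesgue_measure (A i))%E.
Proof.
elim: n A => [A _|n IH A mA].
  by rewrite big_ord0 /= diracE mem_set//= => -[].
rewrite big_ord_recl -IH; last by move=> i; exact: mA.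
rewrite /= /cons_measure /pushforward -product_measure1E//; last first.
  rewrite (_ : [set _ | _] =
      \bigcap_(i in [set: 'I_n]) ((@tnth n _)^~ i @^-1` A (lift ord0 i))).
    apply: fin_bigcap_measurable; first exact: finite_finset.
    by move=> i _; rewrite -[X in measurable X]setTI; exact: measurable_tnth.
  by apply/seteqP; split => t /= h i; [move=> _|]; exact: h.
congr (_ _); apply/seteqP; split => -[x t] /=.
  move=> h; split=> [|i]; first exact: (h ord0).
  by have := h (lift ord0 i); rewrite tnthS.
move=> [Ax At] i; case: (unliftP ord0 i) => [j ->|->//].
by rewrite tnthS; exact: At.
Qed.

Section complex_Lp.
Local Open Scope complex_scope.
Context d (X : measurableType d) (R : realType).
Variable mu : {measure set X -> \bar R}.
Implicit Types (f u : X -> R[i]) (p : \bar R).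

Definition cmeasurable f :=
  measurable_fun [set: X] (fun x => complex.Re (f x)) /\
  measurable_fun [set: X] (fun x => complex.Im (f x)).

Definition cLnorm p f : \bar R := 'N[mu]_p[EFin \o (@Normc.normc R \o f)]%E.

Definition cLfun p : set (X -> R[i]) :=
  [set f | cmeasurable f /\ (cLnorm p f < +oo)%E].

Definition cintegral f : R[i] :=
  (\int[mu]_x complex.Re (f x)) +i* (\int[mu]_x complex.Im (f x)).

(* For K essentially bounded, rho a density and u in L^2, the integrand below
   is integrable for almost every x only; on the remaining null set a divergent
   component of the integral is read as a junk real number, which no L^p norm
   sees. *)
Definition integral_op (k : X * X -> R[i]) u : X -> R[i] :=
  fun x => cintegral (fun y => k (x, y) * u y).

(* A is an operator on L^2 given on representatives (elements of cLfun 2); the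
   supremum runs over the representatives of the closed unit ball. *)
Definition opnorm (A : (X -> R[i]) -> X -> R[i]) : \bar R :=
  ereal_sup [set cLnorm 2%:E (A u) |
             u in [set u | cLfun 2%:E u /\ (cLnorm 2%:E u <= 1)%E]].

Definition density : set (X -> R) :=
  [set rho : X -> R | [/\ mu.-integrable [set: X] (EFin \o rho),
                 \forall x \ae mu, 0 <= rho x &
                 (\int[mu]_x (rho x)%:E = 1)%E]].

Definition sqrt_kernel (K : X * X -> R[i]) (rho : X -> R) : X * X -> R[i] :=
  fun xy => (Num.sqrt (rho xy.1))%:C * K xy * (Num.sqrt (rho xy.2))%:C.

Definition Ttilde (K : X * X -> R[i]) (rho : X -> R) :
    (X -> R[i]) -> X -> R[i] :=
  integral_op (sqrt_kernel K rho).

End complex_Lp.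

(* Main.v *)
(* Write r = sqrt rho and s = sqrt sigma. For almost every x,
     (T_rho u - T_sigma u)(x) = \int K(x,y) (r(x) r(y) - s(x) s(y)) u(y) dy,
   and r(x) r(y) - s(x) s(y) = (r(x) - s(x)) r(y) + s(x) (r(y) - s(y)), so by
   Hoelder, as |r|_2 = 1 and |u|_2 <= 1, its modulus is at most
   |K|_oo (|r(x) - s(x)| + s(x) |r - s|_2). The L^2-norm in x of this bound is at
   most 2 |K|_oo |r - s|_2, by Minkowski and |s|_2 = 1. The second estimate
   follows from |sqrt a - sqrt b|^2 <= |a - b|. *)
Require Import Defs.
From HB Require Import structures.
From mathcomp Require Import all_boot all_order all_algebra.
From mathcomp Require Import all_classical all_reals all_analysis.
From mathcomp Require Import complex.
From mathcomp Require Import measurable_realfun ess_sup_inf ring lra.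
Import Order.TTheory GRing.Theory Num.Theory numFieldNormedType.Exports.

Local Open Scope classical_set_scope.
Local Open Scope ring_scope.
Local Open Scope ereal_scope.

Import Normc.

Set Implicit Arguments.
Unset Strict Implicit.
Unset Printing Implicit Defensive.

(** * Integrals and product null sets under almost-everywhere hypotheses *)

(** The integral of a nonnegative function is a supremum over the simple functions below it, hence
    monotone for arbitrary functions. Raising [g] to +oo on the exceptional null set makes the
    inequality hold everywhere and leaves the integral of [g] unchanged. This form allows [f] to
    come from [Ttilde], whose measurability in x is never established. *)
Lemma ge0_ae_le_integral d (T : measurableType d) (R : realType)
    (mu : {measure set T -> \bar R}) (f g : T -> \bar R) :
  (forall x, 0 <= f x) -> (forall x, 0 <= g x) ->
  measurable_fun [set: T] g -> {ae mu, forall x, f x <= g x} ->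
  \int[mu]_x f x <= \int[mu]_x g x.
Proof.
move=> f0 g0 mg [N [mN N0 fgN]].
pose h x := if x \in N then +oo else g x.
have h0 x : 0 <= h x by rewrite /h; case: ifPn.
have fh x : f x <= h x.
  rewrite /h; case: ifPn => [_|xN]; first by rewrite leey.
  by apply: contraTT xN => fg; rewrite negbK; apply/mem_set/fgN/negP.
have mh : measurable_fun [set: T] h.
  apply: measurable_fun_ifT => //; apply: (measurable_fun_bool true).
  by rewrite setTI (_ : _ @^-1` _ = N)//; apply/seteqP; split => x /=;
     [move/set_mem|exact: mem_set].
rewrite (@ae_eq_integral _ _ _ mu setT h g)//; last first.
  exists N; split => // x /= hgx; apply: contrapT => Nx; apply: hgx => _.
  by rewrite /h memNset.
rewrite ge0_integralTE// [leRHS]ge0_integralTE//; apply: ereal_sup_le.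
by move=> _ [k /= kf <-]; exists k => // x; exact: le_trans (fh x).
Qed.

(** The product measure of the exceptional set [N] is the [m1]-integral of the [m2]-measures of its
    sections. A nonnegative function with zero integral vanishes almost everywhere, so almost every
    section of [N] is null. *)
Lemma ae_prod_section d1 d2 (T1 : measurableType d1) (T2 : measurableType d2)
    (R : realType) (m1 : {sigma_finite_measure set T1 -> \bar R})
    (m2 : {sigma_finite_measure set T2 -> \bar R}) (P : T1 * T2 -> Prop) :
  {ae m1 \x m2, forall z, P z} ->
  {ae m1, forall x, {ae m2, forall y, P (x, y)}}.
Proof.
move=> [N [mN N0 PN]].
have mF := measurable_fun_xsection m2 mN.
have : ae_eq m1 [set: T1] (m2 \o xsection N) (cst 0).
  apply/(ae_eq_integral_abs m1 measurableT mF).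
  by rewrite -[RHS]N0; apply: eq_integral => x _; rewrite gee0_abs.
apply: filterS => x /(_ I) /= xN0.
exists (xsection N x); split => //; first exact: measurable_xsection.
by move=> y /= nP; rewrite /xsection /= inE; apply: PN.
Qed.

(** * Inequalities for the complex modulus and the real square root *)

Section normc_facts.
Local Open Scope ring_scope.
Variable R : rcfType.
Implicit Types z : R[i].

Lemma normc_ge0 z : 0 <= normc z.
Proof. by case: z => a b; exact: sqrtr_ge0. Qed.

Lemma normc_real (a : R) : normc a%:C%C = `|a|.
Proof. by rewrite /= expr0n addr0 sqrtr_sqr. Qed.

Lemma le_norm_Re_normc z : `|complex.Re z| <= normc z.
Proof.
case: z => a b /=; rewrite -sqrtr_sqr ler_sqrt ?addr_ge0 ?sqr_ge0//.
by rewrite lerDl sqr_ge0.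
Qed.

Lemma le_norm_Im_normc z : `|complex.Im z| <= normc z.
Proof.
case: z => a b /=; rewrite -sqrtr_sqr ler_sqrt ?addr_ge0 ?sqr_ge0//.
by rewrite lerDr sqr_ge0.
Qed.

(** Cauchy-Schwarz in the plane, from Lagrange's identity: with z = c + ie, (a^2 + b^2)(c^2 + e^2) -
    (ac + be)^2 = (ae - bc)^2. *)
Lemma le_dot_normc (a b : R) z :
  a * complex.Re z + b * complex.Im z <= normc (Complex a b) * normc z.
Proof.
case: z => c e /=; rewrite -sqrtrM ?addr_ge0 ?sqr_ge0//.
apply: le_trans (ler_norm _) _; rewrite -sqrtr_sqr ler_sqrt; last first.
  by rewrite mulr_ge0 ?addr_ge0 ?sqr_ge0.
rewrite -subr_ge0 (_ : _ - _ = (a * e - b * c) ^+ 2) ?sqr_ge0//.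
by ring.
Qed.

Lemma sqr_normc_Re_Im (a b : R) :
  normc (Complex a b) * normc (Complex a b) = a * a + b * b.
Proof. by rewrite -expr2 /= sqr_sqrtr ?addr_ge0 ?sqr_ge0// !expr2. Qed.

(** If 0 <= x <= y are the two roots, then (y - x)^2 <= (y - x)(y + x) = y^2 - x^2. Since [Num.sqrt]
    is 0 on negative reals, replacing a negative argument by 0 only shortens the distance on the
    right, so the bound also covers the points where a density is negative. *)
Lemma ler_sqr_dist_sqrt (a b : R) : `|Num.sqrt a - Num.sqrt b| ^+ 2 <= `|a - b|.
Proof.
wlog ab : a b / a <= b => [H|].
  by have [/H//|/ltW/H] := leP a b; rewrite distrC (distrC b).
have sab : Num.sqrt a <= Num.sqrt b by exact: ler_wsqrtr.
rewrite distrC (distrC a) !ger0_norm ?subr_ge0//.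
have [a0|a0] := leP a 0.
  rewrite (ler0_sqrtr a0) subr0.
  have [b0|b0] := leP b 0; first by rewrite (ler0_sqrtr b0) expr0n subr_ge0.
  by rewrite sqr_sqrtr ?(ltW b0)// lerDl oppr_ge0.
have b0 := lt_le_trans a0 ab.
rewrite -{2}(sqr_sqrtr (ltW a0)) -{2}(sqr_sqrtr (ltW b0)).
have := sqrtr_ge0 a; move: (Num.sqrt a) (Num.sqrt b) sab => x y; nra.
Qed.

End normc_facts.

(** * Measurability of complex-valued functions, by components *)

Section cmeasurable_facts.
Context d (T : measurableType d) (R : realType).
Implicit Types f g : T -> R[i].

Lemma cmeasurableM f g :
  cmeasurable f -> cmeasurable g -> cmeasurable (fun x => f x * g x)%R.
Proof.
move=> [mf1 mf2] [mg1 mg2]; split.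
- rewrite (_ : (fun _ => _) = (fun x => complex.Re (f x) * complex.Re (g x)
     - complex.Im (f x) * complex.Im (g x))%R); last first.
    by apply/funext => x; case: (f x) (g x) => [? ?] [].
  by apply: measurable_funB; exact: measurable_funM.
- rewrite (_ : (fun _ => _) = (fun x => complex.Re (f x) * complex.Im (g x)
     + complex.Im (f x) * complex.Re (g x))%R); last first.
    by apply/funext => x; case: (f x) (g x) => [? ?] [].
  by apply: measurable_funD; exact: measurable_funM.
Qed.

Lemma cmeasurableB f g :
  cmeasurable f -> cmeasurable g -> cmeasurable (fun x => f x - g x)%R.
Proof.
move=> [mf1 mf2] [mg1 mg2]; split.
- rewrite (_ : (fun _ => _) = (fun x => complex.Re (f x) - complex.Re (g x))%R).
    exact: measurable_funB.
  by apply/funext => x; case: (f x) (g x) => [? ?] [].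
- rewrite (_ : (fun _ => _) = (fun x => complex.Im (f x) - complex.Im (g x))%R).
    exact: measurable_funB.
  by apply/funext => x; case: (f x) (g x) => [? ?] [].
Qed.

Lemma cmeasurable_real (h : T -> R) :
  measurable_fun [set: T] h -> cmeasurable (fun x => (h x)%:C%C).
Proof. by move=> mh; split => //=; exact: measurable_cst. Qed.

Lemma measurable_sqrt (h : T -> R) : measurable_fun [set: T] h ->
  measurable_fun [set: T] (fun x => Num.sqrt (h x)).
Proof.
move=> mh; apply: (measurableT_comp _ mh).
by apply: continuous_measurable_fun; apply: sqrt_continuous.
Qed.

Lemma measurable_normc f :
  cmeasurable f -> measurable_fun [set: T] (fun x => normc (f x)).
Proof.
move=> [mf1 mf2].
rewrite (_ : (fun _ => _) = (fun x => Num.sqrt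
    (complex.Re (f x) ^+ 2 + complex.Im (f x) ^+ 2))%R); last first.
  by apply/funext => x; case: (f x).
by apply/measurable_sqrt/measurable_funD; exact: measurable_funX.
Qed.

Lemma cmeasurable_section d' (T' : measurableType d') (k : T' * T -> R[i]) x :
  cmeasurable k -> cmeasurable (fun y => k (x, y)).
Proof.
by move=> [k1 k2]; split; [exact: (measurable_fun_pair2 x k1)|
  exact: (measurable_fun_pair2 x k2)].
Qed.

End cmeasurable_facts.

(** * The complex integral: triangle inequality and additivity *)

Section cintegral_facts.
Context d (T : measurableType d) (R : realType) (mu : {measure set T -> \bar R}).
Implicit Types f g : T -> R[i].

Definition cintegrable f :=
  cmeasurable f /\ \int[mu]_x (normc (f x))%:E < +oo.

Lemma cintegrable_normc f : cintegrable f ->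
  mu.-integrable [set: T] (fun x => (normc (f x))%:E).
Proof.
move=> [mf foo]; apply/integrableP; split.
  exact/measurable_EFinP/measurable_normc.
by under eq_integral do rewrite gee0_abs ?lee_fin ?normc_ge0//.
Qed.

Lemma cintegrable_Re f : cintegrable f ->
  mu.-integrable [set: T] (fun x => (complex.Re (f x))%:E).
Proof.
move=> fi; apply: (le_integrable measurableT _ _ (cintegrable_normc fi)) => //.
  by apply/measurable_EFinP; case: fi => -[].
by move=> x _; rewrite lee_fin [leRHS]ger0_norm ?normc_ge0// le_norm_Re_normc.
Qed.

Lemma cintegrable_Im f : cintegrable f ->
  mu.-integrable [set: T] (fun x => (complex.Im (f x))%:E).
Proof.
move=> fi; apply: (le_integrable measurableT _ _ (cintegrable_normc fi)) => //.
  by apply/measurable_EFinP; case: fi => -[].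
by move=> x _; rewrite lee_fin [leRHS]ger0_norm ?normc_ge0// le_norm_Im_normc.
Qed.

(* With I the integral, |I|^2 = Re I \int Re f + Im I \int Im f <= |I| \int |f|. *)
Lemma le_normc_cintegral f : cintegrable f ->
  (normc (cintegral mu f))%:E <= \int[mu]_x (normc (f x))%:E.
Proof.
move=> fi; set I := \int[mu]_x _.
have I0 : 0 <= I by apply: integral_ge0 => x _; rewrite lee_fin normc_ge0.
rewrite /cintegral; set a := Rintegral _ _ _; set b := Rintegral _ _ _.
set N := normc _; have := normc_ge0 (Complex a b); rewrite -/N.
rewrite le_eqVlt => /predU1P[<-//|N0].
rewrite -(@lee_pmul2l _ N%:E)//.
rewrite -EFinM {1 2}/N sqr_normc_Re_Im EFinD !EFinM.
have aE : a%:E = \int[mu]_x (complex.Re (f x))%:E.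
  by rewrite fineK//; exact/integrable_fin_num/cintegrable_Re.
have bE : b%:E = \int[mu]_x (complex.Im (f x))%:E.
  by rewrite fineK//; exact/integrable_fin_num/cintegrable_Im.
rewrite {2}aE {2}bE -integralZl//; last exact: cintegrable_Re.
rewrite -integralZl//; last exact: cintegrable_Im.
rewrite -integralZl//; last exact: cintegrable_normc.
have ai := integrableZl measurableT a (cintegrable_Re fi).
have bi := integrableZl measurableT b (cintegrable_Im fi).
rewrite -integralD//; apply: le_integral => //.
- exact: integrableD.
- exact/integrableZl/cintegrable_normc.
- by move=> x _; rewrite -!EFinM -EFinD lee_fin le_dot_normc.
Qed.

Lemma cintegrableB f g : cintegrable f -> cintegrable g ->
  cintegrable (fun x => f x - g x)%R.
Proof.
move=> fi gi; have [mf _] := fi; have [mg _] := gi; split;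
  first exact: cmeasurableB.
have mfg : measurable_fun [set: T] (fun x => normc (f x - g x)%R).
  exact/measurable_normc/cmeasurableB.
apply: (@le_lt_trans _ _ (\int[mu]_x ((normc (f x))%:E + (normc (g x))%:E))).
  apply: ge0_le_integral => //.
  - by move=> x _; rewrite lee_fin normc_ge0.
  - exact/measurable_EFinP.
  - by apply: emeasurable_funD; exact/measurable_EFinP/measurable_normc.
  - move=> x _; rewrite -EFinD lee_fin -(normcN (g x)).
    exact: (le_normcD (f x) (- g x)%R).
rewrite integralD//; [|exact: cintegrable_normc..].
by apply: lte_add_pinfty; [case: fi|case: gi].
Qed.

Lemma cintegralB f g : cintegrable f -> cintegrable g ->
  (cintegral mu f - cintegral mu g)%R = cintegral mu (fun x => f x - g x)%R.
Proof.
move=> fi gi; rewrite /cintegral.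
have -> : Rintegral mu setT (fun x => complex.Re (f x - g x)%R) =
    (Rintegral mu setT (fun x => complex.Re (f x)) -
     Rintegral mu setT (fun x => complex.Re (g x)))%R.
  rewrite -RintegralB//; [|exact: cintegrable_Re..].
  by apply: eq_Rintegral => x _; case: (f x) (g x) => [? ?] [].
have -> // : Rintegral mu setT (fun x => complex.Im (f x - g x)%R) =
    (Rintegral mu setT (fun x => complex.Im (f x)) -
     Rintegral mu setT (fun x => complex.Im (g x)))%R.
rewrite -RintegralB//; [|exact: cintegrable_Im..].
by apply: eq_Rintegral => x _; case: (f x) (g x) => [? ?] [].
Qed.

End cintegral_facts.

(** * Norms of real functions, and square roots of densities in L^2 *)

Section Lnorm_facts.
Context d (T : measurableType d) (R : realType) (mu : {measure set T -> \bar R}).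

Lemma measurable_norm_poweR (p : R) (f : T -> R) : measurable_fun [set: T] f ->
  measurable_fun [set: T] (fun x => `|(EFin \o f) x| `^ p).
Proof.
move=> mf; apply: (measurableT_comp (measurable_poweR p)).
by apply: measurableT_comp => //; exact/measurable_EFinP.
Qed.

(** Meant for [f] the modulus of the difference of two [Ttilde] images and [g] an explicit
    measurable majorant; measurability is therefore asked of [g] alone. *)
Lemma ae_le_Lnorm (p : R) (f g : T -> R) : (0 < p)%R ->
  measurable_fun [set: T] g -> {ae mu, forall x, (`|f x| <= `|g x|)%R} ->
  'N[mu]_p%:E[EFin \o f] <= 'N[mu]_p%:E[EFin \o g].
Proof.
move=> p0 mg fg; rewrite unlock; apply: gt0_ler_poweR.
- by rewrite invr_ge0 ltW.
- by rewrite in_itv/= leey andbT integral_ge0// => x _; exact: poweR_ge0.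
- by rewrite in_itv/= leey andbT integral_ge0// => x _; exact: poweR_ge0.
apply: ge0_ae_le_integral.
- by move=> x; exact: poweR_ge0.
- by move=> x; exact: poweR_ge0.
- exact: measurable_norm_poweR.
- apply: filterS fg => x fg.
  by rewrite /= lee_fin ge0_ler_powR// ?nnegrE// ltW.
Qed.

Lemma Lnorm_scale (p c : R) (f : T -> R) : (0 < p)%R -> (0 <= c)%R ->
  measurable_fun [set: T] f ->
  'N[mu]_p%:E[EFin \o (fun x => c * f x)%R] = c%:E * 'N[mu]_p%:E[EFin \o f].
Proof.
move=> p0 c0 mf; rewrite unlock.
have -> : \int[mu]_x `|(EFin \o (fun x => c * f x)%R) x| `^ p =
    c%:E `^ p * \int[mu]_x `|(EFin \o f) x| `^ p.
  rewrite poweR_EFin -ge0_integralZl ?lee_fin ?powR_ge0//; last 2 first.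
  - exact: measurable_norm_poweR.
  - by move=> x _; exact: poweR_ge0.
  by apply: eq_integral => x _; rewrite /= normrM powRM// ger0_norm.
rewrite poweRM ?poweR_ge0//; last by rewrite integral_ge0// => x _; exact: poweR_ge0.
by rewrite -poweRrM mulfV ?gt_eqF// poweRe1.
Qed.

Lemma Lnorm2E (f : T -> R) :
  'N[mu]_2%:E[EFin \o f] = (\int[mu]_x (f x ^+ 2)%:E) `^ 2^-1.
Proof.
rewrite unlock; congr (_ `^ _); apply: eq_integral => x _.
by rewrite /= powR_mulrn// real_normK// num_real.
Qed.

Lemma hoelder2_integral (f g : T -> R) :
  measurable_fun [set: T] f -> measurable_fun [set: T] g ->
  (forall x, 0 <= f x)%R -> (forall x, 0 <= g x)%R ->
  \int[mu]_x (f x * g x)%:E <= 'N[mu]_2%:E[EFin \o f] * 'N[mu]_2%:E[EFin \o g].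
Proof.
move=> mf mg f0 g0.
have := @hoelder _ _ _ mu f g 2 2 mf mg ltac:(lra) ltac:(lra) ltac:(lra).
by rewrite Lnorm1; under eq_integral do rewrite /= ger0_norm ?mulr_ge0//.
Qed.

Lemma Lnorm2_sqrt_density (rho : T -> R) : density mu rho ->
  'N[mu]_2%:E[EFin \o (Num.sqrt \o rho)] = 1.
Proof.
move=> [irho rho0 rho1]; rewrite Lnorm2E.
have mrho : measurable_fun [set: T] rho.
  by apply/measurable_EFinP; exact: measurable_int irho.
(* The square of [Num.sqrt (rho x)] is rho(x) only where rho(x) >= 0, that is, almost everywhere. *)
rewrite (@ae_eq_integral _ _ _ mu setT (EFin \o rho))//.
- by rewrite rho1 poweR1r.
- by apply/measurable_EFinP/measurable_funX/measurable_sqrt.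
- exact/measurable_EFinP.
- by apply: filterS rho0 => x x0 _ /=; rewrite sqr_sqrtr.
Qed.

Lemma Lnorm2_sqrtB_le (rho sigma : T -> R) :
  measurable_fun [set: T] rho -> measurable_fun [set: T] sigma ->
  'N[mu]_2%:E[EFin \o ((Num.sqrt \o rho) \- (Num.sqrt \o sigma))%R] <=
  'N[mu]_1[EFin \o (rho \- sigma)%R] `^ 2^-1.
Proof.
move=> mrho msigma; rewrite Lnorm2E Lnorm1; apply: gt0_ler_poweR.
- by rewrite invr_ge0.
- by rewrite in_itv/= leey andbT integral_ge0// => x _; rewrite lee_fin sqr_ge0.
- by rewrite in_itv/= leey andbT integral_ge0.
apply: ge0_le_integral => //.
- by move=> x _; rewrite lee_fin sqr_ge0.
- by apply/measurable_EFinP/measurable_funX/measurable_funB; exact: measurable_sqrt.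
- by apply: measurableT_comp => //; apply/measurable_EFinP/measurable_funB.
- move=> x _; rewrite /= lee_fin -[leLHS]ger0_norm ?sqr_ge0// normrX.
  exact: ler_sqr_dist_sqrt.
Qed.

End Lnorm_facts.

Lemma ae_le_cLnormy d (T : measurableType d) (R : realType)
    (mu : {measure set T -> \bar R}) (f : T -> R[i]) :
  {ae mu, forall x, (normc (f x))%:E <= cLnorm mu +oo f}.
Proof.
rewrite /cLnorm unlock; case: ifPn => [_|].
  apply: filterS (ess_sup_ge mu _) => x; apply: le_trans.
  by rewrite lee_fin ler_norm.
(* On a space of total measure 0 the L^oo norm is 0 by convention and bounds nothing pointwise;
   there the whole space serves as the exceptional null set. *)
rewrite -leNgt => muT.
have muT0 : mu setT = 0 by apply/eqP; rewrite eq_le muT measure_ge0.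
by exists setT; split.
Qed.

(** * Pointwise bound on the difference of the two images of a fixed u *)

Section difference_bound.
Context d (T : measurableType d) (R : realType).
Variable mu : {measure set T -> \bar R}.
Variables (K : T * T -> R[i]) (M : R) (u : T -> R[i]).
Hypotheses (mK : cmeasurable K) (M0 : (0 <= M)%R) (mfu : cmeasurable u)
  (u1 : cLnorm mu 2%:E u <= 1).

(** At an x with this property the integrands in y are integrable, so [cintegral] returns a genuine
    integral and no junk value. Almost every x has it when [M] is the essential bound of [K], by
    [ae_prod_section]. *)
Let row_bounded x := {ae mu, forall y, (normc (K (x, y)) <= M)%R}.

Let mnu : measurable_fun [set: T] (fun y => normc (u y)).
Proof. exact: measurable_normc. Qed.

(** Hölder against u, whose L^2 norm is at most 1. The weights used are sqrt rho and |sqrt rho -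
    sqrt sigma|. *)
Let integral_weight_le (w : T -> R) : measurable_fun [set: T] w ->
  (forall y, 0 <= w y)%R ->
  \int[mu]_y (w y * normc (u y))%:E <= 'N[mu]_2%:E[EFin \o w].
Proof.
move=> mw w0.
apply: le_trans (hoelder2_integral mu mw mnu w0 (fun y => normc_ge0 (u y))) _.
by rewrite -[leRHS]mule1; apply: lee_wpmul2l u1; exact: Lnorm_ge0.
Qed.

Lemma normc_sqrt_kernel (rho : T -> R) x y :
  normc (sqrt_kernel K rho (x, y)) =
  (Num.sqrt (rho x) * normc (K (x, y)) * Num.sqrt (rho y))%R.
Proof. by rewrite !normcM !normc_real !ger0_norm ?sqrtr_ge0. Qed.

(** For almost every y the modulus is at most the constant sqrt(rho(x)) M times sqrt(rho(y)) |u(y)|,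
    and the latter product has integral at most |sqrt rho|_2 = 1. *)
Lemma cintegrable_sqrt_kernel (rho : T -> R) x : density mu rho ->
  row_bounded x -> cintegrable mu (fun y => sqrt_kernel K rho (x, y) * u y)%R.
Proof.
move=> drho bx; have rho1 := Lnorm2_sqrt_density drho.
have [irho _ _] := drho.
have mrho : measurable_fun [set: T] (fun y => Num.sqrt (rho y)).
  by apply/measurable_sqrt/measurable_EFinP; exact: measurable_int irho.
split.
  apply: cmeasurableM => //; apply: cmeasurableM.
    apply: cmeasurableM; last exact: cmeasurable_section.
    by apply: cmeasurable_real => /=; exact: measurable_cst.
  exact: cmeasurable_real.
set c := (Num.sqrt (rho x) * M)%R.
have c0 : (0 <= c)%R by rewrite mulr_ge0// sqrtr_ge0.
have mh : measurable_fun [set: T]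
    (fun y => (Num.sqrt (rho y) * normc (u y))%:E).
  exact/measurable_EFinP/measurable_funM.
apply: (@le_lt_trans _ _
    (\int[mu]_y (c%:E * (Num.sqrt (rho y) * normc (u y))%:E))).
  apply: ge0_ae_le_integral.
  - by move=> y; rewrite lee_fin normc_ge0.
  - by move=> y; rewrite -EFinM lee_fin !mulr_ge0 ?sqrtr_ge0 ?normc_ge0.
  - exact: measurable_funeM.
  - apply: filterS bx => y Ky; rewrite -EFinM lee_fin normcM normc_sqrt_kernel.
    rewrite mulrA ler_wpM2r ?normc_ge0// ler_wpM2r ?sqrtr_ge0//.
    by rewrite ler_wpM2l ?sqrtr_ge0.
rewrite ge0_integralZl//; last first.
  by move=> y _; rewrite lee_fin mulr_ge0 ?sqrtr_ge0 ?normc_ge0.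
rewrite lte_mul_pinfty ?lee_fin//.
apply: le_lt_trans (integral_weight_le mrho _) _.
  by move=> y; exact: sqrtr_ge0.
by rewrite rho1 ltry.
Qed.

Lemma normc_TtildeB_le (rho sigma : T -> R) x :
  density mu rho -> density mu sigma -> row_bounded x ->
  (normc (Ttilde mu K rho u x - Ttilde mu K sigma u x)%R)%:E <=
  M%:E * (`|Num.sqrt (rho x) - Num.sqrt (sigma x)|%:E + (Num.sqrt (sigma x))%:E *
    'N[mu]_2%:E[EFin \o ((Num.sqrt \o rho) \- (Num.sqrt \o sigma))%R]).
Proof.
move=> drho dsigma bx; have rho1 := Lnorm2_sqrt_density drho.
have [irho _ _] := drho; have [isigma _ _] := dsigma.
have mrho : measurable_fun [set: T] (fun y => Num.sqrt (rho y)).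
  by apply/measurable_sqrt/measurable_EFinP; exact: measurable_int irho.
have msigma : measurable_fun [set: T] (fun y => Num.sqrt (sigma y)).
  by apply/measurable_sqrt/measurable_EFinP; exact: measurable_int isigma.
have fi := cintegrable_sqrt_kernel drho bx.
have gi := cintegrable_sqrt_kernel dsigma bx.
rewrite /Ttilde /integral_op cintegralB//.
apply: le_trans (le_normc_cintegral (cintegrableB fi gi)) _.
set a := `|_|%R; set b := Num.sqrt (sigma x).
pose r y := Num.sqrt (rho y); pose s y := Num.sqrt (sigma y).
have a0 : (0 <= a)%R by exact: normr_ge0.
have b0 : (0 <= b)%R by exact: sqrtr_ge0.
pose h1 y := (r y * normc (u y))%R.
pose h2 y := (`|r y - s y| * normc (u y))%R.
have h10 y : (0 <= h1 y)%R by rewrite mulr_ge0 ?sqrtr_ge0 ?normc_ge0.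
have h20 y : (0 <= h2 y)%R by rewrite mulr_ge0 ?normc_ge0.
have mh1 : measurable_fun [set: T] (fun y => (h1 y)%:E).
  exact/measurable_EFinP/measurable_funM.
have mdist : measurable_fun [set: T] (fun y => `|r y - s y|%R).
  by apply: measurableT_comp => //; exact: measurable_funB.
have mh2 : measurable_fun [set: T] (fun y => (h2 y)%:E).
  exact/measurable_EFinP/measurable_funM.
have mh : measurable_fun [set: T] (fun y => a%:E * (h1 y)%:E + b%:E * (h2 y)%:E).
  by apply: emeasurable_funD; exact: measurable_funeM.
have h0 y : 0 <= a%:E * (h1 y)%:E + b%:E * (h2 y)%:E.
  by rewrite -!EFinM -EFinD lee_fin addr_ge0// mulr_ge0.
(* The factors [a] = |r(x) - s(x)| and [b] = s(x) do not depend on y, so the majorant integrates to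
   a combination of the integrals of [h1] and [h2]. *)
apply: (@le_trans _ _
    (\int[mu]_y (M%:E * (a%:E * (h1 y)%:E + b%:E * (h2 y)%:E)))).
  apply: ge0_ae_le_integral.
  - by move=> y; rewrite lee_fin normc_ge0.
  - by move=> y; apply: mule_ge0.
  - exact: measurable_funeM.
  - apply: filterS bx => y Ky.
    rewrite [leRHS](_ : _ = (M * (a * h1 y + b * h2 y))%:E)// lee_fin.
    rewrite -mulrBl normcM /sqrt_kernel /= -/(r x) -/(r y) -/(s x) -/(s y).
    (* Collecting the real weights into one coefficient leaves a single factor K(x,y), to which the
       bound [M] applies. *)
    have -> : ((r x)%:C%C * K (x, y) * (r y)%:C%C -
        (s x)%:C%C * K (x, y) * (s y)%:C%C =
        (r x * r y - s x * s y)%:C%C * K (x, y))%R.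
      by rewrite rmorphB !rmorphM /=; ring.
    rewrite normcM normc_real /h1 /h2 mulrA -/(s x).
    rewrite [leRHS](_ : _ = (a * r y + b * `|r y - s y|) * M * normc (u y))%R; last first.
      by ring.
    rewrite ler_wpM2r ?normc_ge0// ler_pM ?normc_ge0//.
    rewrite (_ : _ - _ = (r x - s x) * r y + s x * (r y - s y))%R; last by ring.
    apply: le_trans (ler_normD _ _) _; rewrite !normrM.
    by rewrite (ger0_norm (sqrtr_ge0 (rho y))) (ger0_norm (sqrtr_ge0 (sigma x))).
rewrite ge0_integralZl//.
apply: lee_wpmul2l; first by rewrite lee_fin.
rewrite ge0_integralD//; first last.
- exact: measurable_funeM.
- by move=> y _; rewrite mule_ge0 ?lee_fin.
- exact: measurable_funeM.
- by move=> y _; rewrite mule_ge0 ?lee_fin.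
rewrite ge0_integralZl//; last by move=> y _; rewrite lee_fin.
rewrite ge0_integralZl//; last by move=> y _; rewrite lee_fin.
apply: leeD.
  (* The coefficient 1 of [a] in the target is the L^2 norm of sqrt rho, the weight in [h1]. *)
  rewrite -[leRHS]mule1; apply: lee_wpmul2l; rewrite ?lee_fin// -rho1.
  by apply: integral_weight_le => // y; exact: sqrtr_ge0.
apply: lee_wpmul2l; first by rewrite lee_fin.
apply: le_trans (integral_weight_le mdist _) _ => [y|]; first exact: normr_ge0.
by rewrite -[leRHS]Lnorm_abse.
Qed.

End difference_bound.

(** * From the pointwise bound to the operator norm *)

Section Ttilde_lipschitz.
Context d (T : measurableType d) (R : realType).
Variable mu : {sigma_finite_measure set T -> \bar R}.

Lemma opnorm_TtildeB_le (K : T * T -> R[i]) (rho sigma : T -> R) :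
  cLfun (mu \x mu) +oo K -> density mu rho -> density mu sigma ->
  opnorm mu (fun u => Ttilde mu K rho u \- Ttilde mu K sigma u)%R <=
    2%:E * cLnorm (mu \x mu) +oo K *
    'N[mu]_2%:E[EFin \o ((Num.sqrt \o rho) \- (Num.sqrt \o sigma))%R].
Proof.
move=> [mK Koo] drho dsigma.
apply: ge_ereal_sup => _ [u [[mfu _] u1] <-].
have rho1 := Lnorm2_sqrt_density drho.
have sigma1 := Lnorm2_sqrt_density dsigma.
have [irho _ _] := drho; have [isigma _ _] := dsigma.
have mrho : measurable_fun [set: T] (fun y => Num.sqrt (rho y)).
  by apply/measurable_sqrt/measurable_EFinP; exact: measurable_int irho.
have msigma : measurable_fun [set: T] (fun y => Num.sqrt (sigma y)).
  by apply/measurable_sqrt/measurable_EFinP; exact: measurable_int isigma.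
set D := 'N[mu]_2%:E[_].
(* Minkowski gives D <= 1 + 1. Finiteness lets D enter the real-valued majorant below as the real
   coefficient [D']. *)
have Dfin : D \is a fin_num.
  rewrite ge0_fin_numE ?Lnorm_ge0// /D (_ : _ \o _ = EFin \o
    ((fun y => Num.sqrt (rho y)) \+ (fun y => - Num.sqrt (sigma y)))%R)//.
  apply: le_lt_trans (minkowski_EFin _ _ _ _) _ => //.
  - by apply: measurableT_comp.
  - by rewrite ler1n.
  rewrite (_ : EFin \o (fun y => - _)%R = \- (EFin \o (Num.sqrt \o sigma)))//.
  by rewrite oppe_Lnorm rho1 sigma1 -EFinD ltry.
pose D' := fine D; have DE : D = D'%:E by rewrite fineK.
have D0 : (0 <= D')%R by rewrite -lee_fin -DE Lnorm_ge0.
have Kfin : cLnorm (mu \x mu) +oo K \is a fin_num by rewrite ge0_fin_numE ?Lnorm_ge0.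
pose M := fine (cLnorm (mu \x mu) +oo K).
have ME : cLnorm (mu \x mu) +oo K = M%:E by rewrite fineK.
have M0 : (0 <= M)%R by rewrite -lee_fin -ME Lnorm_ge0.
pose v x := `|Num.sqrt (rho x) - Num.sqrt (sigma x)|%R.
pose w x := Num.sqrt (sigma x).
have mv : measurable_fun [set: T] v.
  by apply: measurableT_comp => //; exact: measurable_funB.
have mDw : measurable_fun [set: T] (fun x => D' * w x)%R by exact: measurable_funM.
have mvw : measurable_fun [set: T] (v \+ (fun x => D' * w x))%R.
  exact: measurable_funD.
(* The majorant M (v + D' w) has L^2 norm at most M (|v|_2 + D' |w|_2). Here |v|_2 = D and |w|_2 =
   1, so the two terms contribute D each, whence the factor 2. *)
apply: (@le_trans _ _
    'N[mu]_2%:E[EFin \o (fun x => M * (v \+ (fun x => D' * w x)) x)%R]).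
  apply: ae_le_Lnorm => //; first exact: measurable_funM.
  (* The essential bound on [K] holds off a null set of the product; passing to sections turns it
     into the row bound required at almost every x. *)
  have Kae : {ae mu, forall x, {ae mu, forall y, (normc (K (x, y)) <= M)%R}}.
    apply: (@ae_prod_section _ _ _ _ _ mu mu (fun z => normc (K z) <= M)%R).
    by apply: filterS (ae_le_cLnormy (mu \x mu) K) => z; rewrite ME lee_fin.
  apply: filterS Kae => x Kx.
  have := normc_TtildeB_le mK M0 mfu u1 drho dsigma Kx.
  rewrite -/D DE => H; rewrite ger0_norm ?normc_ge0// ger0_norm.
    by rewrite -lee_fin /= (mulrC D').
  apply: mulr_ge0 => //; apply: addr_ge0; first exact: normr_ge0.
  by apply: mulr_ge0 => //; exact: sqrtr_ge0.
rewrite Lnorm_scale// ME DE (muleC 2%:E) -muleA; apply: lee_wpmul2l; first by rewrite lee_fin.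
apply: le_trans (minkowski_EFin _ mv mDw _) _; first by rewrite ler1n.
rewrite Lnorm_scale// sigma1 mule1 (_ : EFin \o v =
  abse \o (EFin \o ((Num.sqrt \o rho) \- (Num.sqrt \o sigma))%R))//.
by rewrite Lnorm_abse -/D DE -EFinD -EFinM lee_fin mulr_natl mulr2n.
Qed.

End Ttilde_lipschitz.

(** * The two estimates for Lebesgue measure on R^n *)

Unset Implicit Arguments.
Set Strict Implicit.
Set Printing Implicit Defensive.

Theorem theorem11p2 (R : realType) (n : nat) (hn : (1 <= n)%N)
    (K : Rn R n * Rn R n -> R[i]) :
  let lam := lebesgue_Rn R n in
  cLfun (lam \x lam) +oo K ->
  forall rho sigma : Rn R n -> R, density lam rho -> density lam sigma ->
  let normK := cLnorm (lam \x lam) +oo K in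
  let diff := fun u => (Ttilde lam K rho u \- Ttilde lam K sigma u)%R in
  opnorm lam diff <=
    2%:E * normK *
    'N[lam]_2%:E[EFin \o ((Num.sqrt \o rho) \- (Num.sqrt \o sigma))%R] /\
  opnorm lam diff <=
    2%:E * normK * 'N[lam]_1[EFin \o (rho \- sigma)%R] `^ 2^-1.
Proof.
move=> lam KL rho sigma drho dsigma normK diff.
have H := opnorm_TtildeB_le KL drho dsigma.
split; first exact: H.
apply: le_trans H _; apply: lee_wpmul2l; first by apply: mule_ge0 => //; exact: Lnorm_ge0.
have [irho _ _] := drho; have [isigma _ _] := dsigma.
apply: Lnorm2_sqrtB_le; apply/measurable_EFinP.
- exact: measurable_int irho.
- exact: measurable_int isigma.
Qed.
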